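(* Let $k$ be a fixed positive integer and let $j\in\{1,\ldots,k\}$. For every integer $n$, let $F_n$ be the number of compositions of $n$ all of whose parts lie in $\{1,\ldots,k\}$ (so $F_0=1$, via the empty composition, and $F_n=0$ for $n<0$), and let $C_{n,j}$ be the total number of occurrences of the part $j$ among all such compositions of $n$ (so $C_{n,j}=0$ for $n\le 0$). Then \[ C_{n,j}=\begin{cases}0,& \text{if } n\le 0;\\ F_{n-j}+\sum_{a=1}^k C_{n-a,j}, & \text{if } n>0.\end{cases} \]
   Context: A composition of a nonnegative integer $n$ is a finite sequence of positive integers $(\lambda_1,\ldots,\lambda_m)$ with $\sum_i \lambda_i=n$; the $\lambda_i$ are its parts. The integer $0$ has exactly one composition, the empty one; negative integers have none. *)

(* Defs.v *)
From mathcomp Require Import all_boot all_order all_algebra.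

Set Implicit Arguments.
Unset Strict Implicit.
Unset Printing Implicit Defensive.

(* [n] is an integer, so that a negative [n] has no composition. *)
Definition is_composition (n : int) (s : seq nat) : bool :=
  all (fun p => 0 < p) s && ((sumn s)%:Z == n)%R.

Definition parts_in (k : nat) (s : seq nat) : bool :=
  all (fun p => 1 <= p <= k) s.

(* A composition of [n] has at most [`|n|] parts, so bounded sequences give
   them all: [mem_compositions] and [compositions_uniq] below show that the
   list is exhaustive and without repetition. *)
Definition compositions (k : nat) (n : int) : seq (seq nat) :=
  [seq s <- [seq map val (bseqval t) | t : {bseq `|n|%N of 'I_k.+1}]
    | is_composition n s && parts_in k s].

Definition F (k : nat) (n : int) : nat := size (compositions k n).

Definition C (k : nat) (n : int) (j : nat) : nat :=
  \sum_(s <- compositions k n) count_mem j s.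

Lemma mem_compositions (k : nat) (n : int) (s : seq nat) :
  (s \in compositions k n) = is_composition n s && parts_in k s.
Proof.
rewrite mem_filter andb_idr // => /andP[/andP[pos /eqP <-] les].
have sz : size (map (@inord k) s) <= `|Posz (sumn s)|%N.
  rewrite size_map absz_nat; elim: s pos {les} => //= p s IH /andP[p0 /IH].
  by rewrite -add1n; apply: leq_add.
apply/imageP; exists (Bseq sz) => //=.
rewrite -map_comp -[LHS]map_id; apply/eq_in_map => p /(allP les) /andP[_ pk] /=.
by rewrite inordK.
Qed.

Lemma compositions_uniq (k : nat) (n : int) : uniq (compositions k n).
Proof.
apply: filter_uniq; rewrite map_inj_uniq ?enum_uniq //.
by move=> t u /(inj_map val_inj) /val_inj.
Qed.

(* Main.v *)
Require Import Defs.
From mathcomp Require Import all_boot all_order all_algebra.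
From mathcomp Require Import zify.

(** For [n > 0], deleting the first part [a] matches the compositions of [n] with the pairs of some
    [a] in [1..k] and a composition of [n - a] ([compositions_rec]). An occurrence of [j] is either
    the deleted part, once for each composition of [n - j], or lies in the remainder, which is
    counted by [C k (n - a) j]. *)

Lemma is_composition_cons (n : int) (a : nat) (s : seq nat) :
  is_composition n (a :: s) = (0 < a) && is_composition (n - a%:Z)%R s.
Proof.
rewrite /is_composition /= -andbA; congr (_ && (_ && _)).
by apply/eqP/eqP; lia.
Qed.

(** Positivity of [n] excludes the empty composition, so a first part exists. The two lists may be
    ordered differently, but both are duplicate-free, so comparing members suffices. *)
Lemma compositions_rec (k : nat) (n : int) : (0 < n)%R ->
  perm_eq (compositions k n)
    [seq a :: s | a <- index_iota 1 k.+1, s <- compositions k (n - a%:Z)%R].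
Proof.
move=> n_gt0; apply: uniq_perm; first exact: compositions_uniq.
  apply: allpairs_uniq_dep => [|a _|[a s] [b t] _ _ /= [-> ->] //].
    exact: iota_uniq.
  exact: compositions_uniq.
move=> s; rewrite mem_compositions.
apply/idP/allpairsPdep => [|[a] [t] [a_in t_in ->]].
  case: s => [|a s]; first by rewrite /is_composition /=; lia.
  rewrite is_composition_cons /= => /andP[/andP[a_gt0 s_comp] /andP[a_le s_in]].
  by exists a, s; rewrite mem_index_iota mem_compositions s_comp; split.
move: a_in t_in; rewrite mem_index_iota mem_compositions is_composition_cons /=.
by rewrite ltnS => /andP[a_gt0 a_le] /andP[-> ->]; rewrite a_gt0 a_le.
Qed.

Lemma C_le0 (k : nat) (n : int) (j : nat) : (n <= 0)%R -> C k n j = 0.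
Proof.
move=> n_le0; rewrite /C big_seq big1 // => -[|a s] //.
by rewrite mem_compositions /is_composition /=; lia.
Qed.

Theorem theorem2p2 (k : nat) (hk : 0 < k) (j : nat) (hj : 1 <= j <= k)
    (n : int) :
  C k n j =
    if (n <= 0)%R then 0
    else F k (n - j%:Z)%R + \sum_(1 <= a < k.+1) C k (n - a%:Z)%R j.
Proof.
case: ifPn => [|n_gt0]; first exact: C_le0.
rewrite {1}/C (perm_big _ (compositions_rec k n _)) /=; last by lia.
rewrite big_allpairs_dep /=.
(* The head contributes [a == j] whatever the tail is, in total [(a == j) * F k (n - a)]. *)
under eq_bigr => a _ do rewrite big_split /= big_const_seq iter_addn_0 count_predT.
rewrite big_split /=; congr (_ + _).
(* Only [a = j] survives, and [hj] puts it in range. *)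
rewrite (bigD1_seq j) ?iota_uniq ?mem_index_iota //=.
rewrite eqxx mul1n big1 ?addn0 // => a /negbTE ->.
by rewrite mul0n.
Qed.
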